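(* Let $(T^*Q,G,\omega,\mathbf{J},\mathcal{D},H)$ be a $\mathbf{J}$-nonholonomic point reducible Hamiltonian system with an associated $\mathbf{J}$-nonholonomic $R_p$-reduced distributional Hamiltonian system $(\mathcal{K}_\mu,\omega_{\mathcal{K}_\mu},h_{\mathcal{K}_\mu})$ with dynamical vector field $X_{\mathcal{K}_\mu}$, where $\mu\in\mathfrak{g}^*$ is a regular value of the momentum map $\mathbf{J}$. Let $\gamma:Q\to T^*Q$ be a one-form on $Q$, $\lambda=\gamma\circ\pi_Q:T^*Q\to T^*Q$, and for any symplectic map $\varepsilon:T^*Q\to T^*Q$ put $X_H^{\varepsilon}=T\pi_Q\circ X_H\circ\varepsilon$, where $X_H$ is the dynamical vector field of the corresponding unconstrained Hamiltonian system with symmetry and momentum map $(T^*Q,G,\omega,\mathbf{J},H)$. Assume that $\mathrm{Im}(\gamma)\subset\mathcal{M}\cap\mathbf{J}^{-1}(\mu)$ and it is $G_\mu$-invariant, that $\varepsilon$ is $G_\mu$-invariant and $\varepsilon(\mathbf{J}^{-1}(\mu))\subset\mathbf{J}^{-1}(\mu)$. Put $\bar\gamma_\mu=\pi_\mu\circ\gamma:Q\to\mathcal{M}_\mu$, assume $\mathrm{Im}(T\bar\gamma_\mu)\subset\mathcal{K}_\mu$, and put $\bar\lambda_\mu=\pi_\mu\circ\lambda:\mathbf{J}^{-1}(\mu)\ (\subset T^*Q)\to\mathcal{M}_\mu$ and $\bar\varepsilon_\mu=\pi_\mu\circ\varepsilon:\mathbf{J}^{-1}(\mu)\ (\subset T^*Q)\to\mathcal{M}_\mu$.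 Then $\varepsilon$ and $\bar\varepsilon_\mu$ satisfy the equation $$\tau_{\mathcal{K}_\mu}\circ T\bar\varepsilon_\mu\circ X_{h_{\mathcal{K}_\mu}\circ\bar\varepsilon_\mu}=T\bar\lambda_\mu\circ X_H\circ\varepsilon$$ if and only if they satisfy the equation $$T\bar\gamma_\mu\circ X_H^{\varepsilon}=X_{\mathcal{K}_\mu}\circ\bar\varepsilon_\mu$$ (the Type II Hamilton-Jacobi equation for $(\mathcal{K}_\mu,\omega_{\mathcal{K}_\mu},h_{\mathcal{K}_\mu})$). Here $X_{h_{\mathcal{K}_\mu}\circ\bar\varepsilon_\mu}$ is the Hamiltonian vector field of the function $h_{\mathcal{K}_\mu}\circ\bar\varepsilon_\mu:T^*Q\to\mathbb{R}$.
   Context: $Q$ is a smooth manifold, $\pi_Q:T^*Q\to Q$ the projection, $T\pi_Q:TT^*Q\to TQ$ its tangent map, $\omega=dq^i\wedge dp_i$ the canonical symplectic form on $T^*Q$. $L:TQ\to\mathbb{R}$ is a hyperregular Lagrangian, i.e. its Legendre transformation (fibre derivative) $\mathcal{F}L:TQ\to T^*Q$ is a diffeomorphism, and $H:T^*Q\to\mathbb{R}$, $H(q,p)=\langle p,\dot q\rangle-L(q,\dot q)$ with $p=\mathcal{F}L(q,\dot q)$, is the corresponding Hamiltonian; the Hamiltonian vector field $X_f$ of a function $f$ on $T^*Q$ is defined by $\mathbf{i}_{X_f}\omega=\mathbf{d}f$. $\mathcal{D}\subset TQ$ is a distribution that is completely nonholonomic ($\mathcal{D}$ along with all its iterated Lie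 brackets spans $TQ$) and $\mathcal{D}$-regular (the restriction to $\mathcal{D}$ of the fibre Hessian of $L$ is nondegenerate everywhere). $\mathcal{M}=\mathcal{F}L(\mathcal{D})\subset T^*Q$ is the constraint submanifold and $\mathcal{F}=(T\pi_Q)^{-1}(\mathcal{D})\subset TT^*Q$, a distribution along $\mathcal{M}$. It is also assumed that $\dim\mathcal{M}=\operatorname{rank}\mathcal{F}$ and $T\mathcal{M}\cap\mathcal{F}^{\perp}=\{0\}$ ($\perp$: symplectic orthogonal for $\omega$). A Lie group $G$ (with Lie algebra $\mathfrak{g}$) acts smoothly on the left on $Q$, and by the lifted actions on $TQ$ and $T^*Q$; the cotangent lifted action is free, proper and symplectic and admits an $\operatorname{Ad}^*$-equivariant momentum map $\mathbf{J}:T^*Q\to\mathfrak{g}^*$. $H$ and $\mathcal{D}$ are $G$-invariant, and $\mathcal{M}$ is $G$-invariant. For a regular value $\mu\in\mathfrak{g}^*$ of $\mathbf{J}$, $G_\mu=\{g\in G\mid\operatorname{Ad}_g^*\mu=\mu\}$, $i_\mu:\mathbf{J}^{-1}(\mu)\to T^*Q$ is the inclusion, $\pi_\mu:\mathbf{J}^{-1}(\mu)\to(T^*Q)_\mu=\mathbf{J}^{-1}(\mu)/G_\mu$ the projection, and $\omega_\mu$ the Marsden-Weinstein reduced symplectic form, $\pi_\mu^*\omega_\mu=i_\mu^*\omega$. $h_\mu:(T^*Q)_\mu\to\mathbb{R}$ is defined by $h_\mu\circ\pi_\mu=H\circ i_\mu$. It is assumed that $\mathcal{M}$ intersects $\mathbf{J}^{-1}(\mu)$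 cleanly with $\mathcal{M}\cap\mathbf{J}^{-1}(\mu)\neq\emptyset$, so that $\mathcal{M}_\mu=(\mathcal{M}\cap\mathbf{J}^{-1}(\mu))/G_\mu\subset(T^*Q)_\mu$ is a smooth manifold and $\pi_\mu:\mathcal{M}\cap\mathbf{J}^{-1}(\mu)\to\mathcal{M}_\mu$ a surjective submersion. Let $\omega_{\mathcal{M}_\mu}$ be the pullback of $\omega_\mu$ to $\mathcal{M}_\mu$, $\mathcal{F}_\mu=T\pi_\mu(T(\mathbf{J}^{-1}(\mu))\cap\mathcal{F})$ the pushed-down distribution along $\mathcal{M}_\mu$, and $\mathcal{K}_\mu=\mathcal{F}_\mu\cap T\mathcal{M}_\mu$. It is assumed that $\dim\mathcal{M}_\mu=\operatorname{rank}\mathcal{F}_\mu$ and $T\mathcal{M}_\mu\cap\mathcal{F}_\mu^{\perp}=\{0\}$ ($\perp$ with respect to $\omega_\mu$) and that the fibrewise restriction $\omega_{\mathcal{K}_\mu}$ of $\omega_{\mathcal{M}_\mu}$ to $\mathcal{K}_\mu$ is non-degenerate. $\mathbf{d}h_{\mathcal{K}_\mu}$ is the restriction to $\mathcal{K}_\mu$ of $\mathbf{d}(h_\mu|_{\mathcal{M}_\mu})$, and $X_{\mathcal{K}_\mu}$ is the $\mathcal{K}_\mu$-valued vector field on $\mathcal{M}_\mu$ with $\mathbf{i}_{X_{\mathcal{K}_\mu}}\omega_{\mathcal{K}_\mu}=\mathbf{d}h_{\mathcal{K}_\mu}$. The triple $(\mathcal{K}_\mu,\omega_{\mathcal{K}_\mu},h_{\mathcal{K}_\mu})$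 is the $\mathbf{J}$-nonholonomic $R_p$-reduced (''regular point reduced'') distributional Hamiltonian system. Conventions: a symplectic map is a smooth $\varepsilon$ with $\varepsilon^*\omega=\omega$; it is $G_\mu$-invariant if it commutes with the lifted $G_\mu$-action. $G_\mu$-invariance of $\mathrm{Im}(\gamma)$ is equivalent to $\gamma(gq)=g\cdot\gamma(q)$ for $g\in G_\mu$. $\tau_{\mathcal{K}_\mu}:T(T^*Q)_\mu|_{\mathcal{M}_\mu}\to\mathcal{K}_\mu$ is the projection onto $\mathcal{K}_\mu$ along the symplectic orthogonal of $\mathcal{K}_\mu$ with respect to $\omega_\mu$ (identity on $\mathcal{K}_\mu$). In $h_{\mathcal{K}_\mu}\circ\bar\varepsilon_\mu$, $h_{\mathcal{K}_\mu}$ is represented by $h_\mu$, and the function is regarded as a function on $T^*Q$ via $H\circ\varepsilon$, which equals $h_\mu\circ\bar\varepsilon_\mu$ on $\mathbf{J}^{-1}(\mu)$. The two equations are equations at the points $z\in\mathbf{J}^{-1}(\mu)$; $T\bar\lambda_\mu$ denotes $T(\pi_\mu\circ\lambda)$. *)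

(* Defs.v *)
From HB Require Import structures.
From mathcomp Require Import all_boot all_order all_algebra.
From mathcomp Require Import all_classical all_reals all_analysis.

Set Implicit Arguments.
Unset Strict Implicit.
Unset Printing Implicit Defensive.

Import Order.TTheory GRing.Theory Num.Theory numFieldNormedType.Exports.
Local Open Scope classical_set_scope.
Local Open Scope ring_scope.

Section Linear.
Context {R : realType}.

(* The pairing of a covector with a vector, in dual coordinates. *)
Definition pairing n (p v : 'rV[R]_n) : R := \sum_i p 0 i * v 0 i.

Definition transpose_map a b (A : 'rV[R]_a -> 'rV[R]_b) (p : 'rV[R]_b) :
  'rV[R]_a := \row_j pairing p (A (delta_mx 0 j)).

Definition subspace_of_dim d n (A : set 'rV[R]_n) : Prop :=
  exists2 B : 'M[R]_(d, n), row_free B & A = [set v | (v <= B)%MS].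

Definition sympl_orth n (w : 'rV[R]_n -> 'rV[R]_n -> R) (A : set 'rV[R]_n) :
  set 'rV[R]_n := [set v | forall a, A a -> w v a = 0].

End Linear.

Section Smooth.
Context {R : realType} {n : nat} {V : normedModType R}.

Fixpoint Ck (k : nat) (U : set 'rV[R]_n) (f : 'rV[R]_n -> V) : Prop :=
  match k with
  | 0%N => forall x, U x -> {for x, continuous f}
  | k'.+1 => (forall x, U x -> differentiable f x) /\
             (forall v, Ck k' U (fun x => 'd f x v))
  end.

Definition smooth_on (U : set 'rV[R]_n) (f : 'rV[R]_n -> V) : Prop :=
  open U /\ forall k, Ck k U f.

End Smooth.

(* A set with a family of charts, valued in R^n = 'rV[R]_n.  [cinv i] matters only on the image
   [cmap i @` cdom i], where it inverts [cmap i].  The tangent space at x is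
   'rV[R]_n, a vector being identified with its coordinates in the preferred
   chart [chart_at x].  The laws are in [is_manifold]; keeping them apart lets
   the bundles TM and T^*M and the products be defined by their charts alone. *)
Record charted (R : realType) (n : nat) := Charted {
  mpoint :> Type;
  cidx : Type;
  cdom : cidx -> set mpoint;
  cmap : cidx -> mpoint -> 'rV[R]_n;
  cinv : cidx -> 'rV[R]_n -> mpoint;
  chart_at : mpoint -> cidx }.

Section Charted.
Context {R : realType}.

Definition mopen n (M : charted R n) (U : set M) : Prop :=
  forall i : cidx M, open (cmap i @` (U `&` cdom i)).

Definition mcompact n (M : charted R n) (K : set M) : Prop :=
  forall (I : Type) (U : I -> set M), (forall i, mopen (U i)) ->
    K `<=` \bigcup_i U i ->
    exists2 D : set I, finite_set D & K `<=` \bigcup_(i in D) U i.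

Definition is_manifold n (M : charted R n) : Prop :=
  [/\ forall x : M, cdom (chart_at x) x,
      forall (i : cidx M) x, cdom i x -> cinv i (cmap i x) = x,
      forall i j : cidx M,
        smooth_on (cmap i @` (cdom i `&` cdom j)) (cmap j \o cinv i),
      forall x y : M, x <> y -> exists U V : set M,
        [/\ mopen U, mopen V, U x, V y & U `&` V = set0]
    & exists B : nat -> set M, (forall a, mopen (B a)) /\
        forall (U : set M) x, mopen U -> U x ->
          exists a, B a x /\ B a `<=` U ].

(* f is continuous on the open set U and smooth in all charts. *)
Definition smooth_in n m (M : charted R n) (N : charted R m)
    (U : set M) (f : M -> N) : Prop :=
  forall (i : cidx M) (j : cidx N),
    smooth_on (cmap i @` (U `&` cdom i `&` f @^-1` cdom j))
              (cmap j \o f \o cinv i).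

Definition smooth_map n m (M : charted R n) (N : charted R m) (f : M -> N) :=
  smooth_in setT f.

Definition smooth_fun n (M : charted R n) (f : M -> R) : Prop :=
  forall i : cidx M,
    smooth_on (cmap i @` cdom i) (f \o cinv i : 'rV[R]_n -> R^o).

Definition tmap n m (M : charted R n) (N : charted R m) (f : M -> N)
    (x : M) (v : 'rV[R]_n) : 'rV[R]_m :=
  'd (cmap (chart_at (f x)) \o f \o cinv (chart_at x))
     (cmap (chart_at x) x) v.

Definition dfun n (M : charted R n) (f : M -> R) (x : M) (v : 'rV[R]_n) : R :=
  'd (f \o cinv (chart_at x) : 'rV[R]_n -> R^o) (cmap (chart_at x) x) v.

Definition submersion n m (M : charted R n) (N : charted R m) (f : M -> N) :=
  smooth_map f /\ forall x w, exists v, tmap f x v = w.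

Definition diffeomorphism n m (M : charted R n) (N : charted R m)
    (f : M -> N) : Prop :=
  smooth_map f /\
  exists g : N -> M, [/\ smooth_map g, cancel f g & cancel g f].

Definition embedding n m (M : charted R n) (N : charted R m) (f : M -> N) :=
  [/\ smooth_map f,
      injective f,
      forall x, injective (tmap f x)
    & forall U : set M, mopen U ->
        exists2 V : set N, mopen V & U = f @^-1` V ].

Definition vecspace (k : nat) : charted R k :=
  @Charted R k 'rV[R]_k unit (fun _ => setT) (fun _ => id) (fun _ => id)
    (fun _ => tt).

Definition prodC n m (M : charted R n) (N : charted R m) : charted R (n + m) :=
  @Charted R (n + m) (M * N)%type (cidx M * cidx N)%type
    (fun i => [set z | cdom i.1 z.1 /\ cdom i.2 z.2])
    (fun i z => row_mx (cmap i.1 z.1) (cmap i.2 z.2))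
    (fun i w => (cinv i.1 (lsubmx w), cinv i.2 (rsubmx w)))
    (fun z => (chart_at z.1, chart_at z.2)).

(* Change of coordinates, from chart i to chart j, of tangent vectors at x. *)
Definition coord_change n (M : charted R n) (i j : cidx M) (x : M)
    (v : 'rV[R]_n) : 'rV[R]_n := 'd (cmap j \o cinv i) (cmap i x) v.

(* A point of TM is (x, v), with v the coordinates in [chart_at x]; the charts
   are (q, qdot). *)
Definition tanb n (M : charted R n) : charted R (n + n) :=
  @Charted R (n + n) (M * 'rV[R]_n)%type (cidx M)
    (fun i => [set z | cdom i z.1])
    (fun i z => row_mx (cmap i z.1) (coord_change (chart_at z.1) i z.1 z.2))
    (fun i w => let x := cinv i (lsubmx w) in
                (x, coord_change i (chart_at x) x (rsubmx w)))
    (fun z => chart_at z.1).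

(* A point of T^*M is (x, p), with p the coordinates dual to those of
   [chart_at x]; the charts are (q, p). *)
Definition cotanb n (M : charted R n) : charted R (n + n) :=
  @Charted R (n + n) (M * 'rV[R]_n)%type (cidx M)
    (fun i => [set z | cdom i z.1])
    (fun i z => row_mx (cmap i z.1)
                  (transpose_map (coord_change i (chart_at z.1) z.1) z.2))
    (fun i w => let x := cinv i (lsubmx w) in
                (x, transpose_map (coord_change (chart_at x) i x) (rsubmx w)))
    (fun z => chart_at z.1).

Definition piQ n (M : charted R n) : cotanb M -> M := fun z => z.1.

End Charted.

Record manifold (R : realType) (n : nat) := Manifold {
  mspace :> charted R n;
  mspaceP : is_manifold mspace }.

Record submanifold (R : realType) (n : nat) (M : charted R n) (k : nat) :=
  Submanifold {
    subspace_of :> manifold R k;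
    emb : subspace_of -> M;
    embP : embedding emb }.
Arguments emb {R n M k} s _.

Definition carrier (R : realType) n (M : charted R n) k
    (S : submanifold M k) : set M := range (emb S).

Definition tangent_at (R : realType) n (M : charted R n) k
    (S : submanifold M k) (x : M) : set 'rV[R]_n :=
  [set v | exists2 s : S, emb S s = x & exists u, tmap (emb S) s u = v].

Section Symplectic.
Context {R : realType} {n : nat} {Q : charted R n}.

(* dq^i /\ dp_i on T_z T^*Q, in the chart (q, p) preferred at z; its
   coefficients there do not depend on z. *)
Definition omega (u v : 'rV[R]_(n + n)) : R :=
  pairing (lsubmx u) (rsubmx v) - pairing (lsubmx v) (rsubmx u).

Definition hamiltonian_field (f : cotanb Q -> R)
    (X : cotanb Q -> 'rV[R]_(n + n)) : Prop :=
  forall z v, omega (X z) v = dfun f z v.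

Definition symplectic_map (e : cotanb Q -> cotanb Q) : Prop :=
  smooth_map e /\
  forall z u v, omega (tmap e z u) (tmap e z v) = omega u v.

Definition one_form (g : Q -> cotanb Q) : Prop :=
  smooth_map g /\ forall q, piQ (g q) = q.

End Symplectic.

Section Lagrangian.
Context {R : realType} {n : nat} {Q : charted R n}.

(* d_v L(q, .), the derivative along the fibre T_q Q. *)
Definition fibre_deriv (L : tanb Q -> R) (q : Q) (v w : 'rV[R]_n) : R :=
  'd ((fun v' => L (q, v')) : 'rV[R]_n -> R^o) v w.

Definition fibre_hessian (L : tanb Q -> R) (q : Q) (v w1 w2 : 'rV[R]_n) : R :=
  'd ((fun v' => fibre_deriv L q v' w1) : 'rV[R]_n -> R^o) v w2.

Definition legendre (L : tanb Q -> R) : tanb Q -> cotanb Q :=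
  fun z => (z.1, \row_j fibre_deriv L z.1 z.2 (delta_mx 0 j)).

Definition hyperregular (L : tanb Q -> R) : Prop :=
  smooth_fun L /\ diffeomorphism (legendre L).

Definition hamiltonian_of (L : tanb Q -> R) (H : cotanb Q -> R) : Prop :=
  smooth_fun H /\
  forall z : tanb Q, H (legendre L z) = pairing (legendre L z).2 z.2 - L z.

(* Nondegeneracy on D_q x D_q, at the points (q, v) of D. *)
Definition D_regular (L : tanb Q -> R) (D : set (tanb Q)) : Prop :=
  forall q v, D (q, v) -> forall w1, D (q, w1) ->
    (forall w2, D (q, w2) -> fibre_hessian L q v w1 w2 = 0) -> w1 = 0.

End Lagrangian.

Section Distribution.
Context {R : realType} {n : nat} {Q : charted R n}.

Definition vector_field (U : set Q) (X : Q -> 'rV[R]_n) : Prop :=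
  smooth_in U ((fun x => (x, X x)) : Q -> tanb Q).

Definition smooth_distribution (r : nat) (D : set (tanb Q)) : Prop :=
  forall q, exists U : set Q, exists X : 'I_r -> Q -> 'rV[R]_n,
    [/\ mopen U, U q, forall a, vector_field U (X a)
      & forall x, U x -> row_free (\matrix_a X a x) /\
          forall v, D (x, v) <-> (v <= \matrix_a X a x)%MS ].

Definition local_rep (i : cidx Q) (X : Q -> 'rV[R]_n) (w : 'rV[R]_n) :
  'rV[R]_n := let x := cinv i w in coord_change (chart_at x) i x (X x).

Definition lie_bracket (X Y : Q -> 'rV[R]_n) (x : Q) : 'rV[R]_n :=
  let i := chart_at x in let w := cmap i x in
  'd (local_rep i Y) w (local_rep i X w) -
  'd (local_rep i X) w (local_rep i Y w).

Inductive iterated_bracket (D : set (tanb Q)) (U : set Q) :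
  (Q -> 'rV[R]_n) -> Prop :=
| Section_of X : vector_field U X -> (forall x, U x -> D (x, X x)) ->
    iterated_bracket D U X
| Bracket_of X Y : iterated_bracket D U X -> iterated_bracket D U Y ->
    iterated_bracket D U (lie_bracket X Y).

Definition completely_nonholonomic (D : set (tanb Q)) : Prop :=
  forall q, exists m, exists2 A : 'M[R]_(m, n), row_full A &
    forall a, exists U X,
      [/\ mopen U, U q, iterated_bracket D U X & row a A = X q].

(* The fibre at z of F = (T pi_Q)^-1 (D). *)
Definition lifted_dist (D : set (tanb Q)) (z : cotanb Q) :
  set 'rV[R]_(n + n) := [set w | D (piQ z, tmap (@piQ R n Q) z w)].

End Distribution.

Record lieGroup (R : realType) (k : nat) := LieGroup {
  lgspace :> manifold R k;
  gmul : lgspace -> lgspace -> lgspace;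
  ginv : lgspace -> lgspace;
  gone : lgspace;
  gmulA : forall a b c, gmul a (gmul b c) = gmul (gmul a b) c;
  gmul1 : forall a, gmul gone a = a;
  gmulV : forall a, gmul (ginv a) a = gone;
  gmul_smooth : smooth_map
    ((fun z => gmul z.1 z.2) : prodC lgspace lgspace -> lgspace);
  ginv_smooth : smooth_map ginv }.
Arguments gone {R k}.

Section Actions.
Context {R : realType} {k : nat} {G : lieGroup R k}.

Definition smooth_action m (M : charted R m) (a : G -> M -> M) : Prop :=
  [/\ forall x, a (gone G) x = x,
      forall g h x, a (gmul g h) x = a g (a h x)
    & smooth_map ((fun z => a z.1 z.2) : prodC G M -> M) ].

Definition free_action m (M : charted R m) (a : G -> M -> M) : Prop :=
  forall g x, a g x = x -> g = gone G.

Definition proper_action m (M : charted R m) (a : G -> M -> M) : Prop :=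
  forall K : set (prodC M M), mcompact K ->
    mcompact ([set z | K (z.2, a z.1 z.2)] : set (prodC G M)).

Definition tangent_lift n (Q : charted R n) (a : G -> Q -> Q) :
  G -> tanb Q -> tanb Q := fun g z => (a g z.1, tmap (a g) z.1 z.2).

(* g . p = p \o T_(g q) (g^-1), for p in T_q^*Q. *)
Definition cotangent_lift n (Q : charted R n) (a : G -> Q -> Q) :
  G -> cotanb Q -> cotanb Q :=
  fun g z => (a g z.1, transpose_map (tmap (a (ginv g)) (a g z.1)) z.2).

(* The Lie algebra is T_e G = 'rV[R]_k, and its dual is 'rV[R]_k in the dual
   coordinates. *)
Definition Ad (g : G) : 'rV[R]_k -> 'rV[R]_k :=
  tmap (fun h : G => gmul (gmul g h) (ginv g)) (gone G).

Definition coAd (g : G) (mu : 'rV[R]_k) : 'rV[R]_k := transpose_map (Ad g) mu.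

Definition isotropy (mu : 'rV[R]_k) : set G := [set g | coAd g mu = mu].

Definition generator m (M : charted R m) (a : G -> M -> M)
    (xi : 'rV[R]_k) (x : M) : 'rV[R]_m := tmap (fun g : G => a g x) (gone G) xi.

Definition momentum_map n (Q : charted R n) (a : G -> cotanb Q -> cotanb Q)
    (J : cotanb Q -> vecspace k) : Prop :=
  [/\ smooth_map J,
      forall xi, hamiltonian_field (fun z => pairing (J z) xi) (generator a xi)
    & forall g z, J (a g z) = coAd (ginv g) (J z) ].

Definition regular_value n (Q : charted R n) (J : cotanb Q -> vecspace k)
    (mu : 'rV[R]_k) : Prop :=
  forall z, J z = mu -> forall eta, exists v, tmap J z v = eta.

End Actions.

Section Reduction.
Context {R : realType} {n d m : nat} {Q : charted R n}.
(* N is the level set J^-1(mu) and P its quotient.  The projection pimu is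
   meant on J^-1(mu) only: its values elsewhere are arbitrary, and its
   smoothness and tangent map are those of pimu \o emb N : N -> P. *)
Context {N : submanifold (cotanb Q) d} {P : charted R m}.

Definition proj_level (pimu : cotanb Q -> P) : N -> P :=
  fun x => pimu (emb N x).

Definition quotient_projection (G : Type) (a : G -> cotanb Q -> cotanb Q)
    (Gmu : set G) (pimu : cotanb Q -> P) : Prop :=
  [/\ submersion (proj_level pimu),
      forall y, exists x, proj_level pimu x = y
    & forall x x', proj_level pimu x = proj_level pimu x' <->
        exists2 g, Gmu g & a g (emb N x) = emb N x' ].

(* pimu^* omega_mu = i_mu^* omega; this determines omega_mu. *)
Definition reduced_form (pimu : cotanb Q -> P)
    (om : P -> 'rV[R]_m -> 'rV[R]_m -> R) : Prop :=
  forall x u v,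
    om (proj_level pimu x) (tmap (proj_level pimu) x u)
                           (tmap (proj_level pimu) x v)
    = omega (tmap (emb N) x u) (tmap (emb N) x v).

(* The fibre at y of F_mu = T pi_mu (T (J^-1(mu)) `&` F), along M_mu. *)
Definition reduced_dist (pimu : cotanb Q -> P) (D : set (tanb Q))
    (Mset : set (cotanb Q)) (y : P) : set 'rV[R]_m :=
  [set w | exists x : N,
    [/\ Mset (emb N x), proj_level pimu x = y
      & exists2 u, lifted_dist D (emb N x) (tmap (emb N) x u)
                 & w = tmap (proj_level pimu) x u ] ].

End Reduction.
Arguments proj_level {R n d m Q} N {P} pimu.
Arguments quotient_projection {R n d m Q} N {P G} a Gmu pimu.
Arguments reduced_form {R n d m Q} N {P} pimu om.
Arguments reduced_dist {R n d m Q} N {P} pimu D Mset y.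

(* Main.v *)
From HB Require Import structures.
Require Import Defs.
From mathcomp Require Import all_boot all_order all_algebra.
From mathcomp Require Import all_classical all_reals all_analysis.
From mathcomp Require Import lra.
Import Order.TTheory GRing.Theory Num.Theory numFieldNormedType.Exports.
Local Open Scope classical_set_scope.
Local Open Scope ring_scope.

Set Implicit Arguments.
Unset Strict Implicit.
Unset Printing Implicit Defensive.

(** The two equations have equal sides: the side with [tauK] in the first one and
    the side with [XK] in the second are both the reduced dynamics at
    [epsbar x], and the two other sides agree by the chain rule.

    As [eps] is symplectic, [T eps] carries the Hamiltonian field of [H \o eps]
    to [XH] along [eps] ([symplectic_map_field]), and it is a linear isomorphism
    of each tangent space. By Noether's theorem [XH] is tangent to the level set
    N of the momentum map ([noether], [level_set_tangent]). Since [eps] maps N to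
    itself, [T eps] maps the tangent space of N injectively into a space of the
    same dimension, so the field of [H \o eps] is tangent to N as well, and
    [T epsbar] maps it to [T pimu (XH (eps z))].

    Marsden-Weinstein reduction makes this vector [w] the Hamiltonian vector of
    [hmuf] for the reduced form: [ommu w c = d hmuf c] for all [c]. Its
    projection [tauK w] still satisfies this equation for [c] in [Kmu], which is
    the equation defining [XK]; as [ommu] is nondegenerate on [Kmu], it
    follows that [tauK w = XK] ([sympl_orth_projection_unique]).

    On the other side [lambar] is [gambar \o piQ], so the chain rule turns
    [T lambar XH] into [T gambar XHeps].

    What needs care is the chain rule. A tangent map is a differential in
    preferred charts, so it composes only between maps whose chart expressions
    are differentiable ([mdiff], [tmap_comp]). The maps that [eps] and [gam]
    induce into N have only their composites with the embedding known to be
    smooth; they are differentiable because N is embedded ([embedding_lift]),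
    which rests on an elementary fact about differentials: a continuous map is
    differentiable as soon as its composite with a map of injective differential
    is ([differentiable_lift]). *)

(** * Differentials in normed spaces *)

Section Differentials.
Context {R : realType}.

Lemma diff_eps {V W : normedModType R} (f : V -> W) x : differentiable f x ->
  forall e, 0 < e ->
    \forall h \near 0, `|f (h + x) - f x - 'd f x h| <= e * `|h|.
Proof.
move=> /diff_locallyP[_ /eqaddoP fo] e e0.
apply: filterS (fo e e0) => h /=.
by rewrite [X in `|X|]/GRing.add /= /cst opprD addrA.
Qed.

Lemma eps_diff {V W : normedModType R} (f : V -> W) (df : {linear V -> W}) x :
  continuous df ->
  (forall e, 0 < e ->
     \forall h \near 0, `|f (h + x) - f x - df h| <= e * `|h|) ->
  differentiable f x /\ 'd f x = df :> (V -> W).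
Proof.
move=> dfc fo.
have fdf : f \o shift x = cst (f x) + df +o_ 0 id.
  apply/eqaddoP => e e0; apply: filterS (fo e e0) => h /=.
  by rewrite [X in _ -> is_true (`|X| <= _)]/GRing.add /= /cst opprD addrA.
have dE := diff_unique dfc fdf.
by split=> //; apply/diff_locallyP; rewrite dE.
Qed.

Lemma near_eq_diff {V W : normedModType R} (f g : V -> W) x :
  (\forall y \near x, f y = g y) -> differentiable f x ->
  differentiable g x /\ 'd g x = 'd f x :> (V -> W).
Proof.
move=> fg df; apply: eps_diff; first exact: diff_continuous.
move=> e e0; rewrite -(nbhs_singleton fg).
have fg0 : \forall h \near (0 : V), f (h + x) = g (h + x).
  by move: fg; rewrite (near_shift 0) subr0.
by apply: filterS2 fg0 (diff_eps df e0) => h <-.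
Qed.

Lemma diff_cancel {V W : normedModType R} (f : V -> W) (g : W -> V) x y v :
  f x = y -> differentiable f x -> differentiable g y ->
  (\forall x' \near x, g (f x') = x') -> 'd g y ('d f x v) = v.
Proof.
move=> <- df dg gf.
have near_id : \forall x' \near x, id x' = (g \o f) x'.
  by apply: filterS gf => x' /= ->.
have [_ dE] := near_eq_diff near_id (ex_diff (df := id)).
by move: dE; rewrite diff_comp// diff_val => /(congr1 (@^~ v)).
Qed.

Lemma mulmxr_continuous p q (B : 'M[R]_(p, q)) :
  continuous (fun x : 'rV[R]_p => x *m B).
Proof.
move=> x; apply: differentiable_continuous.
have -> : (fun x : 'rV[R]_p => x *m B)
    = \sum_i (fun x : 'rV[R]_p => x 0 i *: row i B).
  by apply/funext => y; rewrite mulmx_sum_row fct_sumE.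
apply: differentiable_sum => i.
exact/differentiableZl/differentiable_coord.
Qed.

Lemma rV_linear_continuous p q (f : {linear 'rV[R]_p -> 'rV[R]_q}) :
  continuous f.
Proof.
have -> : (f : _ -> _) = (fun x => x *m lin1_mx f).
  by apply/funext => x; rewrite mul_rV_lin1.
exact: mulmxr_continuous.
Qed.

(** The left inverse is given as a matrix so that its continuity comes for
    free. *)
Lemma injective_linear_mulKmx p q (f : {linear 'rV[R]_p -> 'rV[R]_q}) :
  injective f -> exists B : 'M[R]_(q, p), forall v, f v *m B = v.
Proof.
move=> finj; have free : row_free (lin1_mx f).
  by apply/inj_row_free => v; rewrite mul_rV_lin1 -(linear0 f) => /finj.
by exists (pinvmx (lin1_mx f)) => v; rewrite -mul_rV_lin1 mulmxKp.
Qed.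

(** With [B] a left inverse of the differential of [f], the differential of [g]
    can only be [B \o 'd F x]. Expanding [f] at [g x], the increment of [g] is [B]
    applied to that of [F] up to a remainder small with respect to the increment
    of [g] itself; continuity of [g] allows to absorb it, so [g] is Lipschitz at
    [x] and the remainder is small with respect to [h]. *)
Lemma differentiable_lift a b c (g : 'rV[R]_a -> 'rV[R]_b)
    (f : 'rV[R]_b -> 'rV[R]_c) (F : 'rV[R]_a -> 'rV[R]_c) x :
  {for x, continuous g} -> differentiable f (g x) -> injective ('d f (g x)) ->
  (\forall y \near x, f (g y) = F y) -> differentiable F x ->
  differentiable g x.
Proof.
move=> gc df finj fgF dF.
have [B BK] := injective_linear_mulKmx finj.
have [k k0 Bk] := linear_lipschitz (f := mulmxr B) (@mulmxr_continuous _ _ B).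
have [l l0 Fl] := linear_lipschitz (diff_continuous dF).
pose dg : {linear 'rV[R]_a -> 'rV[R]_b} := mulmxr B \o 'd F x.
suff [] : differentiable g x /\ 'd g x = dg :> (_ -> _) by [].
apply: eps_diff; first exact: rV_linear_continuous.
move=> e e0.
have fgF0 : \forall h \near (0 : 'rV[R]_a), f (g (h + x)) = F (h + x).
  by move: fgF; rewrite (near_shift 0) subr0.
have FE := nbhs_singleton fgF.
have gh0 : (fun h => g (h + x) - g x) @ nbhs (0 : 'rV[R]_a) --> (0 : 'rV[R]_b).
  rewrite -[X in _ --> X](subrr (g x)); apply: cvgB; last exact: cvg_cst.
  have -> : (fun h => g (h + x)) = g \o shift x by [].
  by rewrite cvg_comp_shift add0r.
(* [s] and [s'] are slopes allowed to the remainders of [f] and [F]. The first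
   term of [s] makes the remainder of [f] at most half of the increment of [g],
   which gives the Lipschitz constant [C]; the second then makes its
   image under [B] at most e/2 times the norm of [h]. *)
pose C : R := 2 * k * (l + 1).
have k20 : 0 < 2 * k by rewrite mulr_gt0.
have C0 : 0 < C by rewrite /C mulr_gt0 ?mulr_gt0// addr_gt0.
pose s : R := Num.min (1 / (2 * k)) (e / (2 * k * C)).
pose s' : R := Num.min 1 (e / (2 * k)).
have s0 : 0 < s by rewrite /s lt_min !divr_gt0// (mulr_gt0 k20).
have s'0 : 0 < s' by rewrite /s' lt_min ltr01 divr_gt0.
have ks : k * s <= 1 / 2.
  have sk : s <= 1 / (2 * k) by rewrite /s ge_min lexx.
  by move: sk; rewrite ler_pdivlMr//; lra.
have ksC : k * s * C <= e / 2.
  have sk : s <= e / (2 * k * C) by rewrite /s ge_min lexx orbT.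
  by move: sk; rewrite ler_pdivlMr ?(mulr_gt0 k20)//; lra.
have s'1 : s' <= 1 by rewrite /s' ge_min lexx.
have ks' : k * s' <= e / 2.
  have sk : s' <= e / (2 * k) by rewrite /s' ge_min lexx orbT.
  by move: sk; rewrite ler_pdivlMr//; lra.
apply: filterS3 fgF0 (diff_eps dF s'0) (gh0 _ (diff_eps df s0)) => h.
rewrite /= subrK => -> rF; set d := g (h + x) - g x; rewrite FE.
set u := F (h + x) - F x in rF * => rf.
have dE : d = 'd f (g x) d *m B by rewrite BK.
have d1 : `|d| <= k * (l * `|h| + s' * `|h|) + k * s * `|d|.
  rewrite {1}dE -mulrA -mulrDr (le_trans (Bk _))// ler_wpM2l ?(ltW k0)//.
  have -> : 'd f (g x) d = 'd F x h + (u - 'd F x h) - (u - 'd f (g x) d).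
    by rewrite [_ + (u - _)]addrC subrK opprB addrC subrK.
  rewrite (le_trans (ler_normB _ _))// lerD// (le_trans (ler_normD _ _))//.
  by rewrite lerD.
have dC : `|d| <= C * `|h|.
  have h0 := normr_ge0 h; have nd0 := normr_ge0 d.
  have a1 : k * s * `|d| <= 1 / 2 * `|d| by rewrite ler_wpM2r.
  have a2 : k * (l * `|h| + s' * `|h|) <= k * (l * `|h| + `|h|).
    by rewrite ler_wpM2l ?(ltW k0)// lerD2l ler_piMl.
  rewrite /C; lra.
have -> : d - dg h = ('d f (g x) d - 'd F x h) *m B by rewrite mulmxBl -dE.
rewrite (le_trans (Bk _))//.
have -> : 'd f (g x) d - 'd F x h = (u - 'd F x h) - (u - 'd f (g x) d).
  by rewrite opprB [RHS]addrC addrA subrK.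
apply: (@le_trans _ _ (k * (s' * `|h| + s * `|d|))).
  by rewrite ler_wpM2l ?(ltW k0)// (le_trans (ler_normB _ _))// lerD.
have b1 : k * s' * `|h| <= e / 2 * `|h| by rewrite ler_wpM2r.
have b2 : k * s * `|d| <= k * s * (C * `|h|).
  by rewrite ler_wpM2l // mulr_ge0 ?ltW.
have b3 : k * s * C * `|h| <= e / 2 * `|h| by rewrite ler_wpM2r.
rewrite mulrDr !mulrA; move: b2; rewrite mulrA; lra.
Qed.
End Differentials.

(** * Differentiable maps between charted spaces *)

Section ChartedMaps.
Context {R : realType}.

(** The part of the manifold axioms that computations in charts use. It makes
    sense for bundles and products, which are only known by their charts. *)
Definition chart_laws n (M : charted R n) : Prop :=
  (forall x : M, cdom (chart_at x) x) /\
  (forall (i : cidx M) x, cdom i x -> cinv i (cmap i x) = x).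

Lemma manifold_chart_laws n (M : charted R n) : is_manifold M -> chart_laws M.
Proof. by case. Qed.

Definition chart_rep n m (M : charted R n) (N : charted R m) (f : M -> N)
    (x : M) : 'rV[R]_n -> 'rV[R]_m :=
  cmap (chart_at (f x)) \o f \o cinv (chart_at x).

(** Differentiability at one point, read in the preferred charts. The
    neighbourhood condition says that [f] maps the points near [x] into the
    preferred chart at [f x]: the composite [chart_rep], being total, would not
    record it, and without it the chart expressions do not compose. *)
Definition mdiff n m (M : charted R n) (N : charted R m) (f : M -> N)
    (x : M) : Prop :=
  nbhs (cmap (chart_at x) x)
    (cmap (chart_at x) @` (cdom (chart_at x) `&` f @^-1` cdom (chart_at (f x))))
  /\ differentiable (chart_rep f x) (cmap (chart_at x) x).

Lemma tmapE n m (M : charted R n) (N : charted R m) (f : M -> N) (x : M) v :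
  tmap f x v = 'd (chart_rep f x) (cmap (chart_at x) x) v.
Proof. by []. Qed.

Lemma smooth_on_differentiable n (V : normedModType R) (U : set 'rV[R]_n)
    (f : 'rV[R]_n -> V) x : smooth_on U f -> U x -> differentiable f x.
Proof. by case=> _ /(_ 1%N)[fd _] /fd. Qed.

Lemma smooth_map_mdiff n m (M : charted R n) (N : charted R m) (f : M -> N) x :
  chart_laws M -> chart_laws N -> smooth_map f -> mdiff f x.
Proof.
move=> [Md _] [Nd _] /(_ (chart_at x) (chart_at (f x))) fs.
have Ux : (cmap (chart_at x) @` (setT `&` cdom (chart_at x) `&`
    f @^-1` cdom (chart_at (f x)))) (cmap (chart_at x) x).
  by exists x => //; split; [split|]; [|exact: Md|exact: Nd].
split; last exact: smooth_on_differentiable fs Ux.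
by case: fs => Uo _; rewrite setTI in Uo Ux; exact: open_nbhs_nbhs.
Qed.

Lemma tmap_comp n m p (M : charted R n) (N : charted R m) (P : charted R p)
    (f : M -> N) (g : N -> P) x :
  chart_laws M -> chart_laws N -> mdiff f x -> mdiff g (f x) ->
  mdiff (g \o f) x /\
  forall v, tmap (g \o f) x v = tmap g (f x) (tmap f x v).
Proof.
move=> [Md MK] [Nd NK] [fU fd] [gU gd].
pose w := cmap (chart_at x) x.
have fw : chart_rep f x w = cmap (chart_at (f x)) (f x).
  by rewrite /chart_rep /= MK.
have gd' : differentiable (chart_rep g (f x)) (chart_rep f x w) by rewrite fw.
have near_rep : \forall y \near w,
    (chart_rep g (f x) \o chart_rep f x) y = chart_rep (g \o f) x y.
  apply: filterS fU => _ [z [zi fz] <-] /=.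
  by rewrite /chart_rep /= MK// NK.
have [cd cE] := near_eq_diff near_rep (differentiable_comp fd gd').
split; last by move=> v; rewrite !tmapE cE (diff_comp fd gd') fw.
split; last exact: cd.
have gU' : nbhs (chart_rep f x w) (cmap (chart_at (f x)) @`
    (cdom (chart_at (f x)) `&` g @^-1` cdom (chart_at (g (f x))))) by rewrite fw.
have nf : nbhs w (chart_rep f x @^-1` _) :=
  differentiable_continuous fd gU'.
apply: filterS (filterI fU nf) => _ [[z [zi fz] <-] [y [yj gy]]].
rewrite /chart_rep /= (MK _ _ zi) => yz.
have fzy : f z = y.
  by rewrite -(NK (chart_at (f x)) (f z) fz) -yz (NK _ _ yj).
by exists z; [split; [|rewrite /= fzy]|].
Qed.

Lemma smooth_fun_differentiable n (M : charted R n) (h : M -> R) x :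
  chart_laws M -> smooth_fun h ->
  differentiable (h \o cinv (chart_at x) : 'rV[R]_n -> R^o)
    (cmap (chart_at x) x).
Proof.
move=> [Md _] hs; apply: (smooth_on_differentiable (hs _)).
by exists x => //; exact: Md.
Qed.

Lemma dfun_comp n m (M : charted R n) (N : charted R m)
    (f : M -> N) (h : N -> R) x v :
  chart_laws M -> chart_laws N -> mdiff f x ->
  differentiable (h \o cinv (chart_at (f x)) : 'rV[R]_m -> R^o)
    (cmap (chart_at (f x)) (f x)) ->
  dfun (h \o f) x v = dfun h (f x) (tmap f x v).
Proof.
move=> [Md MK] [Nd NK] [fU fd] hd.
pose w := cmap (chart_at x) x.
pose hrep : 'rV[R]_m -> R^o := h \o cinv (chart_at (f x)).
have fw : chart_rep f x w = cmap (chart_at (f x)) (f x).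
  by rewrite /chart_rep /= MK.
have hd' : differentiable hrep (chart_rep f x w) by rewrite fw.
have near_rep : \forall y \near w,
    (hrep \o chart_rep f x) y = (h \o f \o cinv (chart_at x) : _ -> R^o) y.
  apply: filterS fU => _ [z [zi fz] <-] /=.
  by rewrite /hrep /chart_rep /= MK// NK.
have [cd cE] := near_eq_diff near_rep (differentiable_comp fd hd').
by rewrite /dfun cE (diff_comp fd hd') fw.
Qed.

Lemma mopen_preimage n (M : charted R n) (j : cidx M) (A : set 'rV[R]_n) :
  is_manifold M -> open A -> mopen (cdom j `&` cmap j @^-1` A).
Proof.
move=> [Md MK Ms _ _] Ao i.
have -> : cmap i @` (cdom j `&` cmap j @^-1` A `&` cdom i) =
    cmap i @` (cdom i `&` cdom j) `&` (cmap j \o cinv i) @^-1` A.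
  apply/seteqP; split=> [_ [x [[xj xA] xi] <-]|_ [[x [xi xj] <-]]] /=.
    by split; [exists x|rewrite MK].
  by rewrite MK// => xA; exists x.
have [Uo Uc] := Ms i j.
rewrite openE => w [Uw wA].
have nA : nbhs w ((cmap j \o cinv i) @^-1` _) :=
  differentiable_continuous (smooth_on_differentiable (Ms i j) Uw)
    (open_nbhs_nbhs (conj Ao wA)).
by apply: filterI nA; exact: open_nbhs_nbhs.
Qed.

(** The topology of an embedded submanifold is induced, so [g] is continuous
    because [f] is; [differentiable_lift] applied in charts does the rest. *)
Lemma embedding_lift n m k (X : charted R n) (M : charted R m)
    (S : submanifold M k) (f : X -> M) (g : X -> S) x :
  chart_laws X -> chart_laws M -> (forall y, emb S (g y) = f y) ->
  mdiff f x -> mdiff g x.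
Proof.
move=> [Xd XK] [Md MK] gf [fU fd].
have Sm := mspaceP S.
have [Sd SK] := manifold_chart_laws Sm.
have [embs _ embi embo] := embP S.
pose w := cmap (chart_at x) x.
have fw : chart_rep f x w = cmap (chart_at (f x)) (f x).
  by rewrite /chart_rep /= XK.
have near_in (W : set S) : mopen W -> W (g x) -> nbhs w
    (cmap (chart_at x) @` (cdom (chart_at x) `&` g @^-1` W)).
  move=> /embo[V Vo WV] Wgx.
  have Vf : nbhs (chart_rep f x w)
      (cmap (chart_at (f x)) @` (V `&` cdom (chart_at (f x)))).
    rewrite fw; apply: open_nbhs_nbhs; split; first exact: Vo.
    by exists (f x) => //; split=> //; move: Wgx; rewrite WV /= gf.
  have nf : nbhs w (chart_rep f x @^-1` _) :=
    differentiable_continuous fd Vf.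
  apply: filterS (filterI fU nf) => _ [[z [zi fz] <-] [y [Vy yj]]].
  rewrite /chart_rep /= (XK _ _ zi) => yz.
  have fzy : f z = y.
    by rewrite -(MK (chart_at (f x)) (f z) fz) -yz (MK _ _ yj).
  by exists z; [split; [|rewrite /= WV /= gf fzy]|].
pose j := chart_at (g x).
have gU : nbhs w (cmap (chart_at x) @` (cdom (chart_at x) `&` g @^-1` cdom j)).
  apply: near_in; last exact: Sd.
  by have := mopen_preimage (j := j) Sm openT; rewrite preimage_setT setIT.
have gw : chart_rep g x w = cmap j (g x) by rewrite /chart_rep /= XK.
have gc : {for w, continuous (chart_rep g x)}.
  move=> A; rewrite gw nbhsE => -[B [Bo Bg] BA].
  have := near_in _ (mopen_preimage (j := j) Sm Bo) (conj (Sd _) Bg).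
  apply: filterS => _ [z [zi [zj zB]] <-] /=.
  by rewrite /chart_rep /= XK//; exact: BA.
have [eU ed] := smooth_map_mdiff (g x) (manifold_chart_laws Sm) (conj Md MK) embs.
split=> //.
apply: (differentiable_lift (f := chart_rep (emb S) (g x)) gc _ _ _ fd).
- by rewrite gw.
- by rewrite gw; exact: embi.
- apply: filterS gU => _ [z [zi zj] <-].
  by rewrite /chart_rep /= XK// SK// !gf.
Qed.

Lemma tmap_cst n m (M : charted R n) (N : charted R m) (c : N) (x : M) v :
  tmap (fun _ : M => c) x v = 0.
Proof.
by rewrite tmapE (_ : chart_rep _ x = cst (cmap (chart_at c) c)) ?diff_cst.
Qed.

Lemma dfun_cst n (M : charted R n) (c : R) (x : M) v :
  dfun (fun _ : M => c) x v = 0.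
Proof.
rewrite /dfun (_ : _ \o cinv (chart_at x) = cst (c : R^o)) //.
by rewrite diff_cst.
Qed.

End ChartedMaps.

(** * Cotangent bundles and products *)

Section Bundles.
Context {R : realType}.

Lemma linear_sum_delta n (V : lmodType R) (f : {linear 'rV[R]_n -> V}) v :
  f v = \sum_j v 0 j *: f (delta_mx 0 j).
Proof.
by rewrite [in LHS](row_sum_delta v) linear_sum; under eq_bigr do rewrite linearZ.
Qed.

Lemma pairing_delta n (p : 'rV[R]_n) j : pairing p (delta_mx 0 j) = p 0 j.
Proof.
rewrite /pairing (bigD1 j)//= big1 ?addr0 ?mxE ?eqxx ?mulr1//.
by move=> i /negbTE ij; rewrite mxE ij andbF mulr0.
Qed.

Lemma pairingC n (p v : 'rV[R]_n) : pairing p v = pairing v p.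
Proof. by apply: eq_bigr => i _; rewrite mulrC. Qed.

Lemma pairing_inj n (p q : 'rV[R]_n) :
  (forall v, pairing p v = pairing q v) -> p = q.
Proof.
by move=> pq; apply/rowP => j; rewrite -!pairing_delta pq.
Qed.

Lemma pairing_linear n (p : 'rV[R]_n) : linear (pairing p : _ -> R^o).
Proof.
move=> a u v; rewrite /pairing scaler_sumr -big_split; apply: eq_bigr => i _.
by rewrite !mxE mulrDr mulrCA.
Qed.

Lemma pairing_transpose a b (A : {linear 'rV[R]_a -> 'rV[R]_b}) p v :
  pairing (transpose_map A p) v = pairing p (A v).
Proof.
rewrite (linear_sum_delta A v) /pairing.
under [RHS]eq_bigr do rewrite summxE big_distrr.
rewrite exchange_big; apply: eq_bigr => j _.
rewrite mxE mulr_suml; apply: eq_bigr => i _.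
by rewrite !mxE mulrAC -mulrA.
Qed.

(** The chart laws of the cotangent bundle rest on this cocycle
    identity, dualized by [pairing_transpose]. *)
Lemma coord_changeK n (Q : charted R n) (i j : cidx Q) x v :
  is_manifold Q -> cdom i x -> cdom j x ->
  coord_change i j x (coord_change j i x v) = v.
Proof.
move=> [Qd QK Qs _ _] xi xj.
have Uji : (cmap j @` (cdom j `&` cdom i)) (cmap j x) by exists x.
apply: (diff_cancel (f := cmap i \o cinv j) (g := cmap j \o cinv i)).
- by rewrite /= QK.
- exact: smooth_on_differentiable (Qs j i) Uji.
- by apply: smooth_on_differentiable (Qs i j) _; exists x.
- have := open_nbhs_nbhs (conj (Qs j i).1 Uji).
  by apply: filterS => _ [y [yj yi] <-]; rewrite /= (QK j) ?(QK i).
Qed.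

Lemma transpose_coord_changeK n (Q : charted R n) (i j : cidx Q) x p :
  is_manifold Q -> cdom i x -> cdom j x ->
  transpose_map (coord_change i j x) (transpose_map (coord_change j i x) p) = p.
Proof.
move=> Qm xi xj; apply: pairing_inj => v.
rewrite (pairing_transpose ('d (cmap j \o cinv i) (cmap i x))).
rewrite (pairing_transpose ('d (cmap i \o cinv j) (cmap j x))).
by rewrite -[X in pairing p X]/(coord_change j i x (coord_change i j x v))
  coord_changeK.
Qed.

Lemma cotanb_chart_laws n (Q : charted R n) :
  is_manifold Q -> chart_laws (cotanb Q).
Proof.
move=> Qm; have [Qd QK _ _ _] := Qm.
split=> [[q p]|i [q p] qi]; first exact: Qd.
by rewrite /= row_mxKl row_mxKr QK// transpose_coord_changeK.
Qed.

Lemma piQ_mdiff n (Q : charted R n) z : is_manifold Q -> mdiff (@piQ R n Q) z.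
Proof.
move=> Qm; have [Qd QK Qs _ _] := Qm.
set i : cidx Q := chart_at z.1.
set w : 'rV[R]_(n + n) := cmap (chart_at z) z.
have Uo : open (cmap i @` cdom i) by have [] := Qs i i; rewrite setIid.
have lw : nbhs (lsubmx w) (cmap i @` cdom i).
  apply: open_nbhs_nbhs; split; first exact: Uo.
  by exists z.1; [exact: Qd|rewrite /w /= row_mxKl].
have wU : nbhs w (lsubmx @^-1` (cmap i @` cdom i)).
  exact: (continuous_lsubmx lw).
split.
  apply: filterS wU => u [x xi ux].
  exists (x, transpose_map (coord_change (chart_at x) i x) (rsubmx u)) => //=.
  by rewrite transpose_coord_changeK// ux hsubmxK.
suff [] : differentiable (chart_rep (@piQ R n Q) z) w /\
  'd (chart_rep (@piQ R n Q) z) w = 'd lsubmx w :> (_ -> _) by [].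
apply: near_eq_diff (differentiable_lsubmx w).
by apply: filterS wU => u [x xi ux]; rewrite /chart_rep /= -ux QK.
Qed.

Lemma prodC_chart_laws n m (M : charted R n) (N : charted R m) :
  chart_laws M -> chart_laws N -> chart_laws (prodC M N).
Proof.
move=> [Md MK] [Nd NK]; split=> [[x y]|[i j] [x y] /= [xi yj]].
  by split; [exact: Md|exact: Nd].
by rewrite row_mxKl row_mxKr MK// NK.
Qed.

(** Makes the orbit map of a point differentiable, given that the action is
    jointly smooth. *)
Lemma pair_mdiff n m (M : charted R n) (N : charted R m) (x : M) (y : N) :
  is_manifold M -> chart_laws N ->
  mdiff ((fun x' => (x', y)) : M -> prodC M N) x.
Proof.
move=> [Md MK Ms _ _] [Nd NK].
set i := chart_at x; set w := cmap i x.
have Uo : open (cmap i @` cdom i) by have [] := Ms i i; rewrite setIid.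
have wU : nbhs w (cmap i @` cdom i).
  apply: open_nbhs_nbhs; split; first exact: Uo.
  by exists x; first exact: Md.
split.
  apply: filterS wU => _ [x' xi <-]; exists x' => //.
  by split; [|split; [|exact: Nd]].
pose c := row_mx (0 : 'rV[R]_n) (cmap (chart_at y) y).
pose f : 'rV[R]_n -> 'rV[R]_(n + m) := mulmxr (row_mx 1%:M 0) + cst c.
have fd : differentiable f w.
  apply: differentiableD; last exact: differentiable_cst.
  exact/linear_differentiable/mulmxr_continuous.
pose F : M -> prodC M N := fun x' => (x', y).
suff [] : differentiable (chart_rep F x) w /\
  'd (chart_rep F x) w = 'd f w :> (_ -> _) by [].
apply: near_eq_diff fd.
apply: filterS wU => _ [x' xi <-]; rewrite /chart_rep /= MK//.
by rewrite /f [LHS]/GRing.add /= mul_mx_row mulmx1 mulmx0 /c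
  add_row_mx addr0 add0r.
Qed.

End Bundles.

(** * Symplectic linear algebra *)

Section SymplecticLinear.
Context {R : realType}.

Lemma pairing_diff n (p x : 'rV[R]_n) :
  differentiable (pairing p : 'rV[R]_n -> R^o) x /\
  forall v, 'd (pairing p : 'rV[R]_n -> R^o) x v = pairing p v.
Proof.
pose f : {linear 'rV[R]_n -> R^o} :=
  HB.pack (pairing p : 'rV[R]_n -> R^o)
    (GRing.isLinear.Build _ _ _ _ _ (pairing_linear p)).
have fc : continuous f.
  have -> : (f : _ -> R^o) = (fun M : 'M[R]_1 => M 0 0 : R^o) \o mulmxr p^T.
    apply/funext => v; rewrite /= mxE; apply: eq_bigr => i _.
    by rewrite mxE mulrC.
  move=> v; apply: continuous_comp; first exact: mulmxr_continuous.
  exact: coord_continuous.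
split; first exact: (linear_differentiable (f := f)).
by move=> v; rewrite -[LHS]/('d f x v) diff_lin.
Qed.

Lemma pairingBr n (p u v : 'rV[R]_n) :
  pairing p (u - v) = pairing p u - pairing p v.
Proof.
rewrite /pairing -sumrB; apply: eq_bigr => i _.
by rewrite !mxE mulrBr.
Qed.

Lemma pairing0l n (v : 'rV[R]_n) : pairing 0 v = 0.
Proof. by rewrite /pairing big1// => i _; rewrite mxE mul0r. Qed.

Lemma omegaC n (u v : 'rV[R]_(n + n)) : omega u v = - omega v u.
Proof. by rewrite /omega opprB. Qed.

Lemma omegaBl n (u v w : 'rV[R]_(n + n)) :
  omega (u - v) w = omega u w - omega v w.
Proof.
rewrite /omega raddfB [rsubmx (u - v)]raddfB !(pairingC _ (rsubmx w)) !pairingBr.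
by rewrite !opprB addrACA [RHS]addrACA [_ + - _]addrC.
Qed.

Lemma omega_inj n (u v : 'rV[R]_(n + n)) :
  (forall w, omega u w = omega v w) -> u = v.
Proof.
move=> uv; apply/subr0_eq; rewrite -[LHS]hsubmxK.
have {}uv w : omega (u - v) w = 0 by rewrite omegaBl uv subrr.
have -> : lsubmx (u - v) = 0.
  apply: pairing_inj => w; have := uv (row_mx 0 w).
  by rewrite /omega row_mxKl row_mxKr !pairing0l subr0.
have -> : rsubmx (u - v) = 0.
  apply: pairing_inj => w; have := uv (row_mx w 0).
  rewrite /omega row_mxKl row_mxKr [pairing _ 0]pairingC !pairing0l sub0r.
  by move/eqP; rewrite oppr_eq0 pairingC => /eqP.
by rewrite row_mx0.
Qed.

Lemma injective_endo_surjective n (f : {linear 'rV[R]_n -> 'rV[R]_n}) w :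
  injective f -> exists v, f v = w.
Proof.
move=> /injective_linear_mulKmx[B fB].
have AB : lin1_mx f *m B = 1%:M.
  by apply/row_matrixP => i; rewrite !rowE mulmxA mul_rV_lin1 fB mulmx1.
by exists (w *m B); rewrite -mul_rV_lin1 -mulmxA (mulmx1C AB) mulmx1.
Qed.

(** Exactness by counting: the image of [A] lies in the kernel of [B], and both
    have dimension [p - k]. Surjectivity of [B] forces [k <= p], so the
    subtraction is not truncated. *)
Lemma kernel_sub_image p k d (A : {linear 'rV[R]_d -> 'rV[R]_p})
    (B : {linear 'rV[R]_p -> 'rV[R]_k}) w :
  injective A -> (forall v, exists u, B u = v) -> (forall v, B (A v) = 0) ->
  d = (p - k)%N -> B w = 0 -> exists v, A v = w.
Proof.
move=> Ainj Bsurj BA dpk Bw.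
set MA := lin1_mx A; set MB := lin1_mx B.
have rA : \rank MA = d.
  apply/eqP/inj_row_free => v; rewrite mul_rV_lin1 -(linear0 A).
  exact: Ainj.
have rB : \rank MB = k.
  apply/eqP; rewrite -[_ == _]/(row_full MB) -sub1mx; apply/row_subP => i.
  have [u <-] := Bsurj (row i 1%:M).
  by rewrite -mul_rV_lin1 submxMl.
have AkB : (MA <= kermx MB)%MS.
  apply/sub_kermxP/row_matrixP => i.
  by rewrite rowE mulmxA mul_rV_lin1 mul_rV_lin1 BA row0.
have kBA : (kermx MB <= MA)%MS.
  by rewrite -(mxrank_leqif_sup AkB).2 mxrank_ker rA rB dpk.
have /submxP[v wv] : (w <= MA)%MS.
  by apply: submx_trans kBA; apply/sub_kermxP; rewrite mul_rV_lin1.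
by exists v; rewrite wv mul_rV_lin1.
Qed.

End SymplecticLinear.

(** * Hamiltonian fields and momentum maps *)

Section HamiltonianDynamics.
Context {R : realType}.

Lemma symplectic_map_bijective n (Q : charted R n) (e : cotanb Q -> cotanb Q) z :
  symplectic_map e ->
  injective (tmap e z) /\ forall w, exists v, tmap e z v = w.
Proof.
move=> [_ eo].
have inj : injective (tmap e z).
  move=> u v euv; apply: omega_inj => w.
  by rewrite -(eo z) euv eo.
split=> // w; exact: (injective_endo_surjective (f := 'd (chart_rep e z) _)).
Qed.

(** Symplectic maps intertwine Hamiltonian fields: both sides have the same
    pairing with the vectors [tmap e z v], which are all the vectors. *)
Lemma symplectic_map_field n (Q : charted R n) (e : cotanb Q -> cotanb Q)
    (H : cotanb Q -> R) X Y z :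
  is_manifold Q -> symplectic_map e -> smooth_fun H ->
  hamiltonian_field H X -> hamiltonian_field (H \o e) Y ->
  tmap e z (Y z) = X (e z).
Proof.
move=> Qm es Hs HX HY; have [esm eo] := es.
have cQ := cotanb_chart_laws Qm.
apply: omega_inj => w; have [v <-] := (symplectic_map_bijective z es).2 w.
rewrite eo HY HX; apply: dfun_comp => //; first exact: smooth_map_mdiff.
exact: smooth_fun_differentiable.
Qed.

(** Noether's theorem. Paired with [xi], the derivative of [J] along [X] is the
    pairing of [X] with the generator of [xi] up to sign, hence the derivative
    of [H] along an orbit, on which [H] is constant. *)
Lemma noether k (G : lieGroup R k) n (Q : charted R n)
    (a : G -> cotanb Q -> cotanb Q) (J : cotanb Q -> vecspace k) H X z :
  is_manifold Q -> smooth_action a -> momentum_map a J -> smooth_fun H ->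
  (forall g z', H (a g z') = H z') -> hamiltonian_field H X ->
  tmap J z (X z) = 0.
Proof.
move=> Qm [a1 _ asm] [Jsm Jham _] Hs Hinv HX.
have cQ := cotanb_chart_laws Qm.
have cG := manifold_chart_laws (mspaceP G).
have cV : chart_laws (@vecspace R k) by split.
apply: pairing_inj => xi; rewrite pairing0l.
pose orb (g : G) := a g z.
have orbE : mdiff orb (gone G).
  have [] // := @tmap_comp _ _ _ _ _ _ _ (fun g : G => (g, z) : prodC G (cotanb Q))
    (fun y => a y.1 y.2) (gone G) cG (prodC_chart_laws cG cQ).
    exact: pair_mdiff (mspaceP G) cQ.
  by apply: smooth_map_mdiff asm => //; exact: prodC_chart_laws.
have dH0 : dfun H z (generator a xi z) = 0.
  have := @dfun_comp _ _ _ _ _ orb H (gone G) xi cG cQ orbE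
    (smooth_fun_differentiable _ cQ Hs).
  rewrite (_ : H \o orb = fun=> H z) ?dfun_cst; last first.
    by apply/funext => g; rewrite /= Hinv.
  by rewrite {1}/orb a1 => <-.
have := Jham xi z (X z); rewrite omegaC HX dH0 oppr0.
have [pd pE] := pairing_diff xi (J z).
rewrite (_ : (fun _ => _) = (pairing xi : @vecspace R k -> R) \o J); last first.
  by apply/funext => y; rewrite /= pairingC.
rewrite (dfun_comp _ cQ cV) => //; last exact: smooth_map_mdiff.
by rewrite [dfun _ _ _]pE pairingC.
Qed.

Lemma level_set_tangent p k d (M : charted R p) (S : submanifold M d)
    (J : M -> @vecspace R k) mu (s : S) w :
  chart_laws M -> smooth_map J -> (forall s, J (emb S s) = mu) ->
  (forall eta, exists v, tmap J (emb S s) v = eta) -> d = (p - k)%N ->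
  tmap J (emb S s) w = 0 -> exists u, tmap (emb S) s u = w.
Proof.
move=> cM Jsm Jmu Jsurj dpk Jw.
have cV : chart_laws (@vecspace R k) by split.
have cS := manifold_chart_laws (mspaceP S).
have [embs _ embi _] := embP S.
apply: (kernel_sub_image (A := 'd (chart_rep (emb S) s) _)
  (B := 'd (chart_rep J (emb S s)) _) (embi s) Jsurj _ dpk Jw) => v.
have [_ cE] := tmap_comp cS cM (smooth_map_mdiff s cS cM embs)
  (smooth_map_mdiff (emb S s) cM cV Jsm).
rewrite -[LHS]/(tmap J (emb S s) (tmap (emb S) s v)) -cE.
rewrite (_ : J \o emb S = fun=> mu) ?tmap_cst//.
by apply/funext => y; exact: Jmu.
Qed.

End HamiltonianDynamics.

(** * Submanifolds and projections *)

Section ReducedField.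
Context {R : realType}.

Lemma tangent_atB n (M : charted R n) k (S : submanifold M k) y u v :
  tangent_at S y u -> tangent_at S y v -> tangent_at S y (u - v).
Proof.
have [_ embI _ _] := embP S.
move=> [s <- [a <-]] [s' /embI -> [b <-]]; exists s => //; exists (a - b).
by rewrite !tmapE linearB.
Qed.

Lemma subspace_of_dimB d n (A : set 'rV[R]_n) u v :
  subspace_of_dim d A -> A u -> A v -> A (u - v).
Proof. by move=> [B _ ->] /= uB vB; rewrite addmx_sub// eqmx_opp. Qed.

Lemma submanifold_lift d n (M : charted R n) (S : submanifold M d) (X : Type)
    (f : X -> M) :
  (forall x, carrier S (f x)) -> exists g : X -> S, forall x, emb S (g x) = f x.
Proof.
move=> fS.
have [g gE] : {g : X -> S & forall x, emb S (g x) = f x}.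
  by apply: (choice (P := fun x s => emb S s = f x)) => x;
    have [s _ sE] := fS x; exists s.
by exists g.
Qed.

(** Two vectors of [K] with the same pairings with [K] differ by a vector of [K]
    orthogonal to [K]; the projection [t] of [w] has the pairings of [w]. *)
Lemma sympl_orth_projection_unique n (om : 'rV[R]_n -> 'rV[R]_n -> R)
    (K : set 'rV[R]_n) w t X :
  (forall a b c, om (a - b) c = om a c - om b c) ->
  (forall a b, K a -> K b -> K (a - b)) ->
  K `&` sympl_orth om K = [set 0] ->
  K t -> sympl_orth om K (w - t) ->
  K X -> (forall c, K c -> om X c = om w c) -> t = X.
Proof.
move=> omB KB Knd Kt torth KX XE; apply/subr0_eq.
suff : (K `&` sympl_orth om K) (t - X) by rewrite Knd.
split=> [|c Kc]; first exact: KB.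
by have := torth c Kc; rewrite !omB XE// => /subr0_eq ->; rewrite subrr.
Qed.

End ReducedField.

(** * The equivalence *)

Theorem theorem5p3
  (R : realType) (n : nat) (Q : manifold R n)
  (* Lagrangian and Hamiltonian *)
  (L : tanb Q -> R) (hL : hyperregular L)
  (H : cotanb Q -> R) (hH : hamiltonian_of L H)
  (* the nonholonomic constraint *)
  (r : nat) (D : set (tanb Q)) (hD : smooth_distribution r D)
  (hDnh : completely_nonholonomic D) (hDreg : D_regular L D)
  (kM : nat) (M : submanifold (cotanb Q) kM)
  (hM : carrier M = legendre L @` D)
  (hMdim : forall z, carrier M z ->
     subspace_of_dim kM (lifted_dist D z))
  (hMF : forall z, carrier M z ->
     tangent_at M z `&` sympl_orth omega (lifted_dist D z) = [set 0])
  (* the symmetry and the momentum map *)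
  (k : nat) (G : lieGroup R k) (act : G -> Q -> Q)
  (hact : smooth_action act)
  (hactT : smooth_action (tangent_lift act))
  (hactC : smooth_action (cotangent_lift act))
  (hfree : free_action (cotangent_lift act))
  (hproper : proper_action (cotangent_lift act))
  (hsymp : forall g, symplectic_map (cotangent_lift act g))
  (J : cotanb Q -> vecspace k) (hJ : momentum_map (cotangent_lift act) J)
  (hHinv : forall g z, H (cotangent_lift act g z) = H z)
  (hDinv : forall g z, D z -> D (tangent_lift act g z))
  (hMinv : forall g z, carrier M z ->
     carrier M (cotangent_lift act g z))
  (* the regular value mu, its level set N and the reduced space P *)
  (mu : 'rV[R]_k) (hmu : regular_value J mu)
  (N : submanifold (cotanb Q) (n + n - k))
  (hN : carrier N = [set z | J z = mu])
  (m : nat) (P : manifold R m) (pimu : cotanb Q -> P)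
  (hpimu : quotient_projection N (cotangent_lift act) (isotropy mu) pimu)
  (ommu : P -> 'rV[R]_m -> 'rV[R]_m -> R) (hommu : reduced_form N pimu ommu)
  (hmuf : P -> R) (hmuf_smooth : smooth_fun hmuf)
  (hmufE : forall x : N, hmuf (pimu (emb N x)) = H (emb N x))
  (* the clean intersection MJ of M and N, and the reduced constraint Mmu *)
  (kMJ : nat) (MJ : submanifold (cotanb Q) kMJ)
  (hMJ : carrier MJ =
     carrier M `&` carrier N)
  (hclean : forall z, carrier MJ z ->
     tangent_at MJ z = tangent_at M z `&` tangent_at N z)
  (hMJ0 : carrier MJ !=set0)
  (kmu : nat) (Mmu : submanifold P kmu)
  (hMmu : carrier Mmu = pimu @` carrier MJ)
  (hrho : exists rho : MJ -> Mmu,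
     [/\ submersion rho, forall y, exists x, rho x = y
       & forall x, emb Mmu (rho x) = pimu (emb MJ x) ])
  (* F_mu, K_mu and the reduced dynamical vector field *)
  (Fmu : P -> set 'rV[R]_m)
  (hFmu : forall y, Fmu y = reduced_dist N pimu D (carrier M) y)
  (Kmu : P -> set 'rV[R]_m)
  (hKmu : forall y, Kmu y = Fmu y `&` tangent_at Mmu y)
  (hFmudim : forall y, carrier Mmu y -> subspace_of_dim kmu (Fmu y))
  (hMmuF : forall y, carrier Mmu y ->
     tangent_at Mmu y `&` sympl_orth (ommu y) (Fmu y) = [set 0])
  (hKnd : forall y, carrier Mmu y ->
     Kmu y `&` sympl_orth (ommu y) (Kmu y) = [set 0])
  (XK : P -> 'rV[R]_m)
  (hXK : forall y, carrier Mmu y -> Kmu y (XK y))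
  (hXKE : forall (s : Mmu) u, Kmu (emb Mmu s) (tmap (emb Mmu) s u) ->
     ommu (emb Mmu s) (XK (emb Mmu s)) (tmap (emb Mmu) s u)
     = dfun (fun s' : Mmu => hmuf (emb Mmu s')) s u)
  (tauK : P -> 'rV[R]_m -> 'rV[R]_m)
  (htauK : forall y, carrier Mmu y -> forall w,
     Kmu y (tauK y w) /\ sympl_orth (ommu y) (Kmu y) (w - tauK y w))
  (* the unconstrained dynamics *)
  (XH : cotanb Q -> 'rV[R]_(n + n)) (hXH : hamiltonian_field H XH)
  (* gamma, epsilon and the Hamiltonian vector field of H \o epsilon *)
  (gam : Q -> cotanb Q) (hgam : one_form gam)
  (hgamM : range gam `<=` carrier M `&` carrier N)
  (hgaminv : forall g, isotropy mu g -> forall z, range gam z ->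
     range gam (cotangent_lift act g z))
  (hgamK : forall q v, Kmu (pimu (gam q)) (tmap (pimu \o gam : Q -> P) q v))
  (eps : cotanb Q -> cotanb Q) (heps : symplectic_map eps)
  (hepsinv : forall g, isotropy mu g -> forall z,
     eps (cotangent_lift act g z) = cotangent_lift act g (eps z))
  (hepsJ : forall z, J z = mu -> J (eps z) = mu)
  (hepsM : forall x : N, carrier Mmu (pimu (eps (emb N x))))
  (XHe : cotanb Q -> 'rV[R]_(n + n)) (hXHe : hamiltonian_field (H \o eps) XHe) :
  let lam : cotanb Q -> cotanb Q := gam \o @piQ R n Q in
  let gambar : Q -> P := pimu \o gam in
  let lambar : cotanb Q -> P := pimu \o lam in
  let epsbar : N -> P := fun x => pimu (eps (emb N x)) in
  let XHeps : cotanb Q -> 'rV[R]_n :=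
    fun z => tmap (@piQ R n Q) (eps z) (XH (eps z)) in
  (* equalities of tangent vectors (base point, vector) of P, at all z = emb N x
     in the level set; u is XHe z as a vector tangent to the level set *)
  (forall x : N, exists2 u, tmap (emb N) x u = XHe (emb N x) &
     (epsbar x, tauK (epsbar x) (tmap epsbar x u)) =
     (lambar (eps (emb N x)), tmap lambar (eps (emb N x)) (XH (eps (emb N x)))))
  <->
  (forall x : N,
     (gambar (piQ (eps (emb N x))),
      tmap gambar (piQ (eps (emb N x))) (XHeps (emb N x))) =
     (epsbar x, XK (epsbar x))).
Proof.
move=> lam gambar lambar epsbar XHeps.
have Qm := mspaceP Q; have cQ := manifold_chart_laws Qm.
have cT := cotanb_chart_laws Qm.
have cN := manifold_chart_laws (mspaceP N).
have cP := manifold_chart_laws (mspaceP P).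
have cMmu := manifold_chart_laws (mspaceP Mmu).
have [embNs _ embNi _] := embP N.
have [embMs _ _ _] := embP Mmu.
have embNd (x : N) := smooth_map_mdiff x cN cT embNs.
have [HHs _] := hH; have [epss epsw] := heps.
have epsd z := smooth_map_mdiff z cT cT epss.
have [[projs proj_sub] _ _] := hpimu.
pose proj := proj_level N pimu.
have projd (x : N) : mdiff proj x := smooth_map_mdiff x cN cP projs.
have NJ (x : N) : J (emb N x) = mu.
  by have : carrier N (emb N x); [exists x|rewrite hN].
have [e eE] : exists e : N -> N, forall x, emb N (e x) = eps (emb N x).
  by apply: submanifold_lift => x; rewrite hN; exact/hepsJ/NJ.
have epsNd x := tmap_comp cN cT (embNd x) (epsd (emb N x)).
have ed (x : N) : mdiff e x.
  by apply: (embedding_lift cN cT) (epsNd x).1 => y; rewrite eE.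
have Te x v : tmap (emb N) (e x) (tmap e x v)
    = tmap eps (emb N x) (tmap (emb N) x v).
  rewrite -(tmap_comp cN cN (ed x) (embNd (e x))).2.
  have -> : emb N \o e = eps \o emb N by apply/funext => y; exact: eE.
  exact: (epsNd x).2.
have [g gE] : exists g : Q -> N, forall q, emb N (g q) = gam q.
  by apply: submanifold_lift => q; apply: (hgamM _ _).2; exists q.
have gd (q : Q) : mdiff g q.
  apply: (embedding_lift cQ cT gE).
  exact: smooth_map_mdiff q cQ cT hgam.1.
have gambarE : gambar = proj \o g.
  by apply/funext => q; rewrite /gambar /proj /proj_level /= gE.
have epsbarE : epsbar = proj \o e.
  by apply/funext => x; rewrite /epsbar /proj /proj_level /= eE.
have Tepsbar x v : tmap epsbar x v = tmap proj (e x) (tmap e x v).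
  by rewrite epsbarE (tmap_comp cN cN (ed x) (projd (e x))).2.
have Tlambar z v : tmap lambar z v = tmap gambar (piQ z) (tmap (@piQ R n Q) z v).
  have gambard : mdiff gambar (piQ z).
    by rewrite gambarE; exact: (tmap_comp cQ cN (gd _) (projd _)).1.
  exact: (tmap_comp cT cQ (piQ_mdiff z Qm) gambard).2.
have XHtan (x : N) : exists u, tmap (emb N) x u = XH (emb N x).
  have Jz := noether (emb N x) Qm hactC hJ HHs hHinv hXH.
  have [Jsm _ _] := hJ.
  by apply: (level_set_tangent cT Jsm NJ _ _ Jz) => //; exact/hmu/NJ.
have XHeE z : tmap eps z (XHe z) = XH (eps z).
  exact: symplectic_map_field heps HHs hXH hXHe.
(* [T e] is injective, hence onto the tangent space of the level set. *)
have tangent_part x u' : tmap (emb N) (e x) u' = XH (eps (emb N x)) ->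
    exists2 u, tmap (emb N) x u = XHe (emb N x) & tmap e x u = u'.
  move=> u'E.
  have einj : injective (tmap e x).
    move=> u v uv; apply: (embNi x).
    apply: (symplectic_map_bijective (emb N x) heps).1.
    by rewrite -!Te uv.
  have [u uE] : exists u, tmap e x u = u'.
    exact: (injective_endo_surjective (f := 'd (chart_rep e x) _)).
  exists u => //; apply: (symplectic_map_bijective (emb N x) heps).1.
  by rewrite -Te XHeE -u'E uE.
have reduced x u' : tmap (emb N) (e x) u' = XH (eps (emb N x)) ->
    tauK (epsbar x) (tmap proj (e x) u') = XK (epsbar x).
  move=> u'E; have My := hepsM x; rewrite -/(epsbar x) in My.
  have yE : epsbar x = proj (e x) by rewrite epsbarE.
  set y := epsbar x in My yE *; set w := tmap _ _ _.
  (* [ommu] is known through lifts of its arguments to the level set, and every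
     tangent vector has one; so it inherits its linearity from [omega]. *)
  have omBl a b c : ommu y (a - b) c = ommu y a c - ommu y b c.
    have [a' <-] := proj_sub (e x) a; have [b' <-] := proj_sub (e x) b.
    have [c' <-] := proj_sub (e x) c.
    rewrite yE !tmapE -linearB -!tmapE !hommu !tmapE linearB.
    exact: omegaBl.
  have omw c : ommu y w c = dfun hmuf y c.
    have [c' <-] := proj_sub (e x) c.
    rewrite yE hommu u'E -eE hXH.
    rewrite -(dfun_comp _ cN cT (embNd _) (smooth_fun_differentiable _ cT HHs)).
    rewrite -(dfun_comp _ cN cP (projd _)
      (smooth_fun_differentiable _ cP hmuf_smooth)).
    suff -> : hmuf \o proj = H \o emb N by [].
    by apply/funext => s; exact: hmufE.
  have [tK torth] := htauK _ My w.
  apply: (sympl_orth_projection_unique omBl _ (hKnd _ My) tK torth (hXK _ My)).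
    move=> a b; rewrite !hKmu => -[aF aT] [bF bT].
    by split; [exact: subspace_of_dimB (hFmudim _ My) aF bF|exact: tangent_atB].
  move=> c cK; move: (cK); rewrite hKmu => -[_ [s sy [v vc]]].
  have cK' : Kmu (emb Mmu s) (tmap (emb Mmu) s v) by rewrite sy vc.
  have := hXKE _ _ cK'.
  rewrite (dfun_comp _ cMmu cP (smooth_map_mdiff s cMmu cP embMs)
    (smooth_fun_differentiable _ cP hmuf_smooth)).
  by rewrite sy vc omw.
have lhsE (x : N) : (exists2 u, tmap (emb N) x u = XHe (emb N x) &
     (epsbar x, tauK (epsbar x) (tmap epsbar x u)) =
     (lambar (eps (emb N x)), tmap lambar (eps (emb N x)) (XH (eps (emb N x)))))
    <-> (gambar (piQ (eps (emb N x))),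
      tmap gambar (piQ (eps (emb N x))) (XHeps (emb N x))) =
     (epsbar x, XK (epsbar x)).
  have [u' u'E] := XHtan (e x); rewrite eE in u'E.
  have [u uE eu] := tangent_part x u' u'E.
  have tauE : tauK (epsbar x) (tmap epsbar x u) = XK (epsbar x).
    by rewrite Tepsbar eu; exact: reduced.
  rewrite Tlambar; split=> [[u0 u0E]|eq]; last by exists u; rewrite ?tauE.
  by rewrite -(embNi _ _ _ (etrans uE (esym u0E))) tauE.
by split=> hyp x; apply/lhsE.
Qed.
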